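(* Let $G$ be a connected triangle-free graph of order $n(G)$ that has no universal vertex (no vertex adjacent to all other vertices). Then $\mu(S(G)) \ge n(G) + \mu_{it}(G)$.
   Context: All graphs are finite and simple. A universal vertex of $G$ is a vertex adjacent to every other vertex of $G$ (so the single vertex of $K_1$ is universal). The shadow graph $S(G)$ of a graph $G$ is obtained from $G$ by adding, for each vertex $v$ of $G$, a new vertex $v'$ (the shadow vertex of $v$), and joining $v'$ to all neighbours of $v$ in $G$ (shadow vertices are pairwise non-adjacent). For a vertex set $X$ of a graph $H$, two vertices $u,v$ are $X$-visible if there is a shortest $u,v$-path $P$ in $H$ with $V(P)\cap X \subseteq \{u,v\}$. The set $X$ is a mutual-visibility set if every two vertices of $X$ are $X$-visible, and a total mutual-visibility set if every two vertices of $H$ are $X$-visible. $\mu(H)$ is the maximum cardinality of a mutual-visibility set of $H$, and $\mu_{it}(H)$ is the maximum cardinality of a total mutual-visibility set of $H$ that is an independent set (it may be $0$, attained by the empty set). *)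

(* Defs.v *)
From mathcomp Require Import all_boot.
From mathcomp Require Import boolp.

Set Implicit Arguments.
Unset Strict Implicit.
Unset Printing Implicit Defensive.

Record sgraph := SGraph {
  vertex :> finType;
  adj : rel vertex;
  adj_sym : symmetric adj;
  adj_irrefl : irreflexive adj
}.

Definition connected (G : sgraph) : Prop :=
  forall u v : G, connect (@adj G) u v.

Definition triangle_free (G : sgraph) : Prop :=
  forall x y z : G, ~ [/\ adj x y, adj y z & adj z x].

Definition universal (G : sgraph) (v : G) : Prop :=
  forall u : G, u <> v -> adj v u.

Definition independent (G : sgraph) (X : {set G}) : Prop :=
  forall u v : G, u \in X -> v \in X -> ~~ adj u v.

Section Shadow.
Variable G : sgraph.

(* [inl v] is the original vertex v and [inr v] is its shadow v'. *)
Definition shadow_adj : rel (G + G)%type := fun a b =>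
  match a, b with
  | inl u, inl v => adj u v
  | inl u, inr v => adj v u
  | inr u, inl v => adj u v
  | inr _, inr _ => false
  end.

Lemma shadow_adj_sym : symmetric shadow_adj.
Proof. by move=> [u|u] [v|v] //=; rewrite adj_sym. Qed.

Lemma shadow_adj_irrefl : irreflexive shadow_adj.
Proof. by move=> [u|u] //=; rewrite adj_irrefl. Qed.

Definition shadow : sgraph := SGraph shadow_adj_sym shadow_adj_irrefl.

End Shadow.

(* The vertex sequence of the path is [u :: p]. *)
Definition is_path (G : sgraph) (u v : G) (p : seq G) : Prop :=
  [/\ path (@adj G) u p, last u p = v & uniq (u :: p)].

Definition shortest_path (G : sgraph) (u v : G) (p : seq G) : Prop :=
  is_path u v p /\ forall q : seq G, is_path u v q -> size p <= size q.

Definition visible (G : sgraph) (X : {set G}) (u v : G) : Prop :=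
  exists p : seq G, shortest_path u v p /\
    forall w : G, w \in u :: p -> w \in X -> w = u \/ w = v.

Definition mutual_visibility (G : sgraph) (X : {set G}) : Prop :=
  forall u v : G, u \in X -> v \in X -> visible X u v.

Definition total_mutual_visibility (G : sgraph) (X : {set G}) : Prop :=
  forall u v : G, visible X u v.

Definition mu (G : sgraph) : nat :=
  \max_(X : {set G} | `[< mutual_visibility X >]) #|X|.

Definition mu_it (G : sgraph) : nat :=
  \max_(X : {set G} | `[< total_mutual_visibility X /\ independent X >]) #|X|.

(* Main.v *)
(* If X is an independent total mutual-visibility set of G, then X together
   with all the shadow vertices is a mutual-visibility set of S(G).  Sending
   each shadow to its original is a graph homomorphism, so a shortest path of G
   whose inner vertices avoid X stays shortest in S(G) when only its ends are
   replaced by shadows.  This fails only for u, u' and for u', v' with u, v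
   adjacent.  There one uses u, w, u' with w a neighbour of u outside X, and
   u', v, w, v' with w a neighbour of v outside X (exchanging u and v if v is in
   X); such w exist because every vertex sees some non-neighbour past X.  The
   path from u' to v' is shortest because u and v have no common neighbour. *)
Require Import Defs.
From mathcomp Require Import all_boot.
From mathcomp Require Import boolp.

Set Implicit Arguments.
Unset Strict Implicit.
Unset Printing Implicit Defensive.

Section Walks.

Variable G : sgraph.
Implicit Types (u v w : G) (p s : seq G) (X : {set G}).

Definition walk u v p : bool := path (@adj G) u p && (last u p == v).

Definition shortest_walk u v p : Prop :=
  walk u v p /\ forall q, walk u v q -> size p <= size q.

Lemma connect_shortest_walk u v :
  connect (@adj G) u v -> exists p, shortest_walk u v p.
Proof.
case/connectP=> p path_p v_last.
have walk_of_size : exists n, [exists q : n.-tuple G, walk u v q].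
  exists (size p); apply/existsP; exists (in_tuple p).
  by rewrite /walk path_p v_last /=.
case: (ex_minnP walk_of_size) => n /existsP[q walk_q] min_n.
exists q; split=> // r walk_r; rewrite size_tuple.
by apply: min_n; apply/existsP; exists (in_tuple r).
Qed.

Lemma shortest_pathP u v p : shortest_path u v p <-> shortest_walk u v p.
Proof.
split=> [[[path_p last_p _] min_p] | [/andP[path_p /eqP last_p] min_p]].
  split=> [|q /andP[path_q /eqP]]; first by rewrite /walk path_p last_p /=.
  case/shortenP: path_q => r path_r uniq_r sub_rq last_r.
  apply: leq_trans (min_p r _) (uniq_leq_size _ sub_rq); first by split.
  by case/andP: uniq_r.
split=> [|q [path_q last_q _]]; last first.
  by apply: min_p; rewrite /walk path_q last_q /=.
split=> //; move: last_p min_p.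
case/shortenP: path_p => r path_r uniq_r sub_rp last_r min_p.
apply: (leq_size_uniq uniq_r) => [x|].
  by rewrite !inE => /predU1P[->|/sub_rp ->]; rewrite ?eqxx ?orbT.
by apply: min_p; rewrite /walk path_r last_r /=.
Qed.

Lemma visible_refl X u : visible X u u.
Proof.
exists [::]; split; first by split.
by move=> w; rewrite inE => /eqP ->; left.
Qed.

Lemma visible_walkP X u v : u != v ->
  visible X u v <-> exists2 s, shortest_walk u v (rcons s v) & all [predC X] s.
Proof.
move=> uv; split=> [[p [sp_p avoid_p]] | [s sw_s avoid_s]].
  have [[_ last_p uniq_p] _] := sp_p; move/shortest_pathP in sp_p.
  case/lastP: p => [|s z] in last_p uniq_p sp_p avoid_p *.
    by rewrite -last_p /= eqxx in uv.
  move: last_p; rewrite last_rcons => z_v; rewrite {z}z_v in uniq_p sp_p avoid_p.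
  exists s => //; apply/allP => w ws /=; apply/negP => wX.
  move: uniq_p; rewrite -rcons_cons rcons_uniq inE negb_or => /and3P[/andP[_ vs] us _].
  have w_in : w \in u :: rcons s v by rewrite inE mem_rcons inE ws !orbT.
  by case: (avoid_p w w_in wX) => wE; rewrite -wE ws in us vs.
exists (rcons s v); split; first exact/shortest_pathP.
move=> w; rewrite inE mem_rcons inE => /or3P[/eqP-> | /eqP-> |]; [by left | by right |].
by move/(allP avoid_s)/negP.
Qed.

Lemma visible_set0 u v : connect (@adj G) u v -> visible set0 u v.
Proof.
case/connect_shortest_walk=> p /shortest_pathP sp_p.
by exists p; split=> // w _; rewrite inE.
Qed.

Lemma visible_nonadj_neighbour X u v :
  visible X u v -> u != v -> ~~ adj u v -> exists2 w, adj u w & w \notin X.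
Proof.
move=> + uv nadj_uv; case/(visible_walkP _ uv)=> -[|w s] [/andP[path_s _] _].
  by rewrite /= (negPf nadj_uv) in path_s.
by case/andP: path_s => uw _ /andP[wX _]; exists w.
Qed.

Lemma total_visibility_neighbour X u :
  total_mutual_visibility X -> ~ universal u -> exists2 w, adj u w & w \notin X.
Proof.
move=> tmvX /existsNP[v /not_implyP[/eqP vu /negP nadj_uv]].
by apply: visible_nonadj_neighbour (tmvX u v) _ nadj_uv; rewrite eq_sym.
Qed.

Lemma visible_common_neighbour X u v w :
  u != v -> ~~ adj u v -> adj u w -> adj w v -> w \notin X -> visible X u v.
Proof.
move=> uv nadj_uv uw wv wX; apply/visible_walkP => //.
exists [:: w]; last by rewrite /= wX.
split=> [|q]; first by rewrite /walk /= uw wv eqxx.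
case: q => [|x [|y q]] //; rewrite /walk /= ?andbT; first by rewrite (negPf uv).
by case/andP=> ux /eqP xv; rewrite -xv ux in nadj_uv.
Qed.

Lemma visible_no_common_neighbour X u v x y :
  u != v -> ~~ adj u v -> (forall w, ~ (adj u w /\ adj w v)) ->
  adj u x -> adj x y -> adj y v -> x \notin X -> y \notin X -> visible X u v.
Proof.
move=> uv nadj_uv no_common ux xy yv xX yX; apply/visible_walkP => //.
exists [:: x; y]; last by rewrite /= xX yX.
split=> [|q]; first by rewrite /walk /= ux xy yv eqxx.
case: q => [|a [|b [|c q]]] //; rewrite /walk /= ?andbT; first by rewrite (negPf uv).
  by case/andP=> ua /eqP av; rewrite -av ua in nadj_uv.
by case/andP=> /andP[ua ab] /eqP bv; case: (no_common a); rewrite -bv.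
Qed.

Lemma leq_mu X : mutual_visibility X -> #|X| <= mu G.
Proof. by move=> mvX; apply: leq_bigmax_cond; apply/asboolP. Qed.

Lemma mu_it_attained : connected G ->
  exists X, [/\ total_mutual_visibility X, independent X & #|X| = mu_it G].
Proof.
move=> connG.
pose P := [pred X : {set G} | `[< total_mutual_visibility X /\ independent X >]].
have [|X /asboolP[tmvX indX] muX] := @eq_bigmax_cond _ P (fun X : {set G} => #|X|).
  apply/card_gt0P; exists set0; apply/asboolP; split=> u v; last by rewrite inE.
  exact: visible_set0 (connG u v).
by exists X.
Qed.

End Walks.

Lemma walk_homo (G H : sgraph) (f : G -> H) (u v : G) (p : seq G) :
  {homo f : x y / adj x y} -> walk u v p -> walk (f u) (f v) (map f p).
Proof.
move=> f_homo /andP[path_p /eqP <-].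
by rewrite /walk last_map eqxx andbT; apply: homo_path path_p.
Qed.

Lemma shortest_walk_lift (G H : sgraph) (f : G -> H) (u v : G) (p : seq G) :
  {homo f : x y / adj x y} -> walk u v p ->
  shortest_walk (f u) (f v) (map f p) -> shortest_walk u v p.
Proof.
move=> f_homo walk_p [_ min_p]; split=> // q /(walk_homo f_homo) /min_p.
by rewrite !size_map.
Qed.

Section ShadowVisibility.

Variable G : sgraph.
Implicit Types (u v w : G) (a b : shadow G) (X : {set G}).

Definition shadow_origin a : G := match a with inl v | inr v => v end.

Definition adjoin_shadows X : {set shadow G} :=
  [set a | if a is inl v then v \in X else true].

Lemma card_adjoin_shadows X : #|adjoin_shadows X| = #|G| + #|X|.
Proof.
rewrite -sum1_card big_sumType addnC -!sum1_card /=.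
by congr (_ + _); apply: eq_bigl => x; rewrite inE.
Qed.

Lemma shadow_origin_homo : {homo shadow_origin : a b / adj a b}.
Proof. by case=> u [] v //=; rewrite adj_sym. Qed.

Lemma adj_inl_l u b : adj (inl u : shadow G) b = adj u (shadow_origin b).
Proof. by case: b => v //=; rewrite adj_sym. Qed.

Lemma adj_inl_r a v : adj a (inl v : shadow G) = adj (shadow_origin a) v.
Proof. by case: a. Qed.

Lemma path_map_inl u b (s : seq G) :
  path (@adj (shadow G)) (inl u) (rcons (map inl s) b) =
  path (@adj G) u (rcons s (shadow_origin b)).
Proof. by rewrite !rcons_path path_map last_map adj_inl_l. Qed.

Lemma path_shadow_lift a b (s : seq G) :
  (adj (shadow_origin a) (shadow_origin b) -> adj a b) ->
  path (@adj G) (shadow_origin a) (rcons s (shadow_origin b)) ->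
  path (@adj (shadow G)) a (rcons (map inl s) b).
Proof.
case: s => [|x s] adj_ab; first by rewrite /= !andbT.
by rewrite [path _ _ _]/(adj _ _ && path _ _ _) -adj_inl_r -path_map_inl.
Qed.

Lemma visible_shadow_lift X a b :
  shadow_origin a != shadow_origin b ->
  (adj (shadow_origin a) (shadow_origin b) -> adj a b) ->
  visible X (shadow_origin a) (shadow_origin b) ->
  visible (adjoin_shadows X) a b.
Proof.
move=> origin_ab adj_ab /(visible_walkP _ origin_ab)[s sw_s avoid_s].
apply/visible_walkP; first by apply: contraNneq origin_ab => ->.
exists (map inl s : seq (shadow G)); last first.
  by rewrite all_map; apply: sub_all avoid_s => x /=; rewrite inE.
apply: (shortest_walk_lift shadow_origin_homo); last first.
  by rewrite map_rcons -map_comp map_id.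
have [/andP[path_s _] _] := sw_s.
by rewrite /walk last_rcons eqxx andbT path_shadow_lift.
Qed.

Lemma visible_same_origin X a b :
  (exists2 w, adj (shadow_origin a) w & w \notin X) ->
  shadow_origin a = shadow_origin b -> visible (adjoin_shadows X) a b.
Proof.
move=> [w aw wX] origin_ab.
have [->|ab] := eqVneq a b; first exact: visible_refl.
apply: (@visible_common_neighbour (shadow G) _ _ _ (inl w)) => //.
- by apply/negP => /shadow_origin_homo; rewrite origin_ab adj_irrefl.
- by rewrite adj_inl_r.
- by rewrite adj_inl_l adj_sym -origin_ab.
- by rewrite inE.
Qed.

Lemma visible_adj_shadows X u v x y :
  triangle_free G -> adj u v -> adj u x -> adj x y -> adj y v ->
  x \notin X -> y \notin X ->
  visible (adjoin_shadows X) (inr u : shadow G) (inr v).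
Proof.
move=> tfG uv ux xy yv xX yX.
apply: (@visible_no_common_neighbour (shadow G) _ _ _ (inl x) (inl y)) => //.
- by apply: contraTneq uv => -[->]; rewrite adj_irrefl.
- case=> w [//= uw vw]; apply: (tfG u w v).
  by rewrite uw (adj_sym w) vw adj_sym.
- by rewrite adj_inl_l.
- by rewrite inE.
- by rewrite inE.
Qed.

Lemma adjoin_shadows_mutual_visibility X :
  triangle_free G -> (forall v, ~ universal v) ->
  total_mutual_visibility X -> independent X ->
  mutual_visibility (adjoin_shadows X).
Proof.
move=> tfG no_universal tmvX indX a b _ _.
have neighbour u := total_visibility_neighbour tmvX (no_universal u).
have [origin_ab | origin_ab] := eqVneq (shadow_origin a) (shadow_origin b).
  exact: visible_same_origin.
have [adj_ab | nlift] := boolP (adj (shadow_origin a) (shadow_origin b) ==> adj a b).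
  by apply: visible_shadow_lift => //; apply/implyP.
case: a b nlift {origin_ab} => u [] v /=; rewrite negb_imply ?andbN //.
  by rewrite adj_sym andbN.
rewrite andbT => uv.
have [vX | vX] := boolP (v \in X).
  have uX : u \notin X by apply: contraTN uv => uX; exact: indX.
  have [w uw wX] := neighbour u.
  by apply: (@visible_adj_shadows _ _ _ w u); rewrite // adj_sym.
have [w vw wX] := neighbour v.
by apply: (@visible_adj_shadows _ _ _ v w); rewrite // adj_sym.
Qed.

End ShadowVisibility.

Theorem theorem4p4 (G : sgraph) :
  connected G ->
  triangle_free G ->
  (forall v : G, ~ universal v) ->
  mu (shadow G) >= #|G| + mu_it G.
Proof.
move=> connG tfG no_universal.
have [X [tmvX indX <-]] := mu_it_attained connG.
rewrite -card_adjoin_shadows.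
exact/leq_mu/adjoin_shadows_mutual_visibility.
Qed.
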